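(* Let $K>0$ and $\Gamma>0$ be real gains, and consider the scalar system $$\frac{d\theta}{dt} = f(\theta,t) + B(t)\,\tilde u,\qquad B(t)=\sum_{i\in\{x,y,z\}}\lambda_i(t)\,\mathbf{w}_i\cdot\mathbf{b}(t),$$ with turning angle $\theta(t)$, unknown constant true weights $\mathbf{w}_i\in\mathbb{R}^n$, and a differentiable target turning angle $\theta_t(t)$. Put $e:=\theta-\theta_t$. Suppose that the control law $$\tilde u := -\frac{1}{\sum_i \lambda_i \hat{\mathbf{w}}_i\cdot\mathbf{b}}\left[f(\theta,t) - \frac{d\theta_t}{dt} + K e\right]$$ is applied (with $\sum_i \lambda_i \hat{\mathbf{w}}_i\cdot\mathbf{b}\neq 0$, so that it is well-defined), and that the weight estimates $\hat{\mathbf{w}}_i(t)\in\mathbb{R}^n$ evolve according to the update laws $$\frac{d\hat{\mathbf{w}}_i}{dt} := \Gamma\, e\,\lambda_i\,\tilde u\,\mathbf{b},\qquad i\in\{x,y,z\}.$$ Then the function $$V := \frac12 e^2 + \frac12\Gamma^{-1}\sum_{i\in\{x,y,z\}}\|\hat{\mathbf{w}}_i-\mathbf{w}_i\|^2$$ is decreasing along the flow, i.e. along every solution of this closed-loop system.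
   Context: Setting. $\theta$ is the turning angle (a continuous, unrestricted real-valued angle of the velocity direction) of a kite trajectory projected onto the unit sphere. $u$ is the steering input, $u^*$ its current value, and $\tilde u=u-u^*$ the steering increment. The system is $d\theta/dt=f(\theta,t)+B(t)\tilde u$, where $f=\left.d\theta/dt\right|_{u^*}$ is the known (measured) value of $d\theta/dt$ at the current steering input, and $B=\left.\partial^2\theta/\partial u\,\partial t\right|_{u^*}$. The function $B$ has the form $B(t)=\sum_{i\in\{x,y,z\}}\lambda_i(t)\,\mathbf{w}_i\cdot\mathbf{b}(t)$, where $\lambda_i(t)\in\mathbb{R}$ are known coefficients, $\mathbf{b}(t)\in\mathbb{R}^n$ is the vector of values of known B-spline basis functions at the current steering input, and $\mathbf{w}_i\in\mathbb{R}^n$ are the constant unknown true weights of the B-spline networks. $\hat{\mathbf{w}}_i(t)$ denotes the estimate of $\mathbf{w}_i$ and $\|\cdot\|$ is the Euclidean norm. ''Decreasing along the flow'' means: along solutions $dV/dt\le 0$ at all times, with $dV/dt<0$ at every time at which $e\neq 0$. *)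

(* Defs.v *)
From HB Require Import structures.
From mathcomp Require Import all_boot all_order all_algebra.
From mathcomp Require Import all_classical all_reals all_analysis.

Set Implicit Arguments.
Unset Strict Implicit.
Unset Printing Implicit Defensive.

Import Order.TTheory GRing.Theory Num.Theory.
Import numFieldNormedType.Exports.

Local Open Scope classical_set_scope.
Local Open Scope ring_scope.

Definition dotv (R : realType) (n : nat) (u v : 'rV[R]_n) : R :=
  \sum_(j < n) u 0 j * v 0 j.

(* The library norm `|v| on row vectors is the sup norm, hence this definition.
   The two norms induce the same topology, so vector limits are unaffected. *)
Definition enorm (R : realType) (n : nat) (v : 'rV[R]_n) : R :=
  Num.sqrt (dotv v v).

Definition time_interval (R : realType) (J : set R) : Prop :=
  is_interval J /\ exists s t, [/\ J s, J t & s < t].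

(* Derivative along J: the ordinary derivative at interior points of J (see
   has_derivative_interiorE), the one-sided one at an endpoint that belongs to
   J, such as the initial time of a solution on [t0, +oo[. *)
Definition has_derivative (R : realType) (V : normedModType R) (J : set R)
    (x : R -> V) (t : R) (l : V) : Prop :=
  (s - t)^-1 *: (x s - x t) @[s --> within J t^'] --> l.

Lemma has_derivative_interiorE (R : realType) (V : normedModType R)
    (J : set R) (x : R -> V) (t : R) (l : V) :
  J° t -> has_derivative J x t l <-> is_derive t (1 : R) x l.
Proof.
rewrite /interior /= => Jt; rewrite /has_derivative.
have -> : within J t^' = t^' :> set_system R.
  apply/seteqP; split => A; rewrite /dnbhs /within /=.
    by apply: filterS2 Jt => s Js AJ st; exact: AJ.
  by apply: filterS => s As st _; exact: As.
have -> : (s - t)^-1 *: (x s - x t) @[s --> t^'] =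
    (fun h : R => h^-1 *: ((x \o shift t) (h *: (1 : R)) - x t)) @ 0^'.
  apply/funext => A; rewrite /fmap /= /dnbhs /within /=.
  rewrite [LHS](near_shift 0 t); congr (nbhs _ _); apply/funext => h /=.
  have hE : h *: (1 : R) = h by rewrite /GRing.scale /= mulr1.
  by rewrite subr0 addrK hE -subr_eq0 addrK.
split=> [xl|xl].
  split; first by apply/cvg_ex; exists l.
  exact/cvg_lim.
rewrite -(@derive_val _ _ _ _ _ _ _ xl).
exact: (@ex_derive _ _ _ _ _ _ _ xl).
Qed.

(* The index set {x, y, z} is 'I_3. *)
Definition gain (R : realType) (n : nat) (lambda : 'I_3 -> R -> R)
    (b : R -> 'rV[R]_n) (w : 'I_3 -> 'rV[R]_n) (t : R) : R :=
  \sum_i lambda i t * dotv (w i) (b t).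

Definition lyapunov (R : realType) (n : nat) (Gamma : R) (e : R -> R)
    (w : 'I_3 -> 'rV[R]_n) (what : 'I_3 -> R -> 'rV[R]_n) (t : R) : R :=
  2^-1 * e t ^+ 2 + 2^-1 * Gamma^-1 * \sum_i enorm (what i t - w i) ^+ 2.

Definition decreasing_along_flow (R : realType) (J : set R) (e V : R -> R) :
    Prop :=
  forall t, J t -> exists v : R,
    [/\ has_derivative J V t v, v <= 0 & e t != 0 -> v < 0].

(* Main.v *)
(* Along a solution, e' = f - theta_t' + B utilde, and the update laws make the
   weight-error part of V' equal to e utilde (Bhat - B), where Bhat is the
   estimated gain.  The unknown B cancels, so V' = e (f - theta_t' + Bhat utilde),
   which is - K e^2 by the control law. *)
Require Import Defs.
From HB Require Import structures.
From mathcomp Require Import all_boot all_order all_algebra.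
From mathcomp Require Import all_classical all_reals all_analysis.
From mathcomp Require Import ring.
Import Order.TTheory GRing.Theory Num.Theory.
Import numFieldNormedType.Exports.
Local Open Scope classical_set_scope.
Local Open Scope ring_scope.

Section has_derivative_calculus.
Context {R : realType} {J : set R} {t : R}.

Lemma has_derivativeD {V : normedModType R} {x y : R -> V} {l m : V} :
  has_derivative J x t l -> has_derivative J y t m ->
  has_derivative J (fun s => x s + y s) t (l + m).
Proof.
rewrite /has_derivative => xl ym.
under eq_fun do rewrite opprD addrACA scalerDr.
exact: cvgD.
Qed.

Lemma has_derivative_cst {V : normedModType R} (a : V) :
  has_derivative J (fun=> a) t 0.
Proof.
rewrite /has_derivative subrr.
under eq_fun do rewrite scaler0.
exact: cvg_cst.
Qed.

Lemma has_derivative_sum {V : normedModType R} {I : Type} (r : seq I)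
    {x : I -> R -> V} {l : I -> V} :
  (forall i, has_derivative J (x i) t (l i)) ->
  has_derivative J (fun s => \sum_(i <- r) x i s) t (\sum_(i <- r) l i).
Proof.
move=> xl; elim: r => [|i r IHr].
  rewrite big_nil; under eq_fun do rewrite big_nil.
  exact: has_derivative_cst.
rewrite big_cons; under eq_fun do rewrite big_cons.
exact: has_derivativeD.
Qed.

Lemma has_derivativeZ {V : normedModType R} (a : R) {x : R -> V} {l : V} :
  has_derivative J x t l -> has_derivative J (fun s => a *: x s) t (a *: l).
Proof.
rewrite /has_derivative => xl.
under eq_fun do rewrite -scalerBr scalerA mulrC -scalerA.
exact: cvgZ (cvg_cst a) xl.
Qed.

Lemma has_derivativeB {V : normedModType R} {x y : R -> V} {l m : V} :
  has_derivative J x t l -> has_derivative J y t m ->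
  has_derivative J (fun s => x s - y s) t (l - m).
Proof.
move=> xl /(has_derivativeZ (-1)) /(has_derivativeD xl).
by rewrite scaleN1r; under eq_fun do rewrite scaleN1r.
Qed.

(** Write [x s] as [x t] plus [s - t] times the difference quotient: the first factor tends to 0 and
    the second to [l], so the product vanishes in the limit. *)
Lemma has_derivative_cvg {V : normedModType R} {x : R -> V} {l : V} :
  has_derivative J x t l -> x s @[s --> within J t^'] --> x t.
Proof.
rewrite /has_derivative => xl.
have st : (s - t) @[s --> within J t^'] --> (0 : R).
  have tt : s @[s --> within J t^'] --> t.
    by apply: (cvg_trans (cvg_within _)); exact: cvg_within.
  by rewrite -(subrr t); exact: cvgB tt (cvg_cst _).
have xt : x t + (s - t) *: ((s - t)^-1 *: (x s - x t))
    @[s --> within J t^'] --> x t.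
  rewrite -[X in _ --> X]addr0 -(scale0r l).
  exact: cvgD (cvg_cst _) (cvgZ st xl).
refine (cvg_trans (near_eq_cvg _) xt).
rewrite near_withinE; near=> s => _.
(* Cancelling [s - t] against its inverse requires [s != t], which the punctured filter provides. *)
have sBt : s - t != 0 by rewrite subr_eq0; near: s; exact: nbhs_dnbhs_neq.
by rewrite scalerA divff// scale1r addrC subrK.
Unshelve. all: by end_near. Qed.

(** The difference of squares factors as the difference quotient times [x s + x t], and the latter
    tends to [x t + x t] by continuity. *)
Lemma has_derivative_sqr {x : R -> R} {l : R} :
  has_derivative J x t l ->
  has_derivative J (fun s => x s ^+ 2) t (2 * x t * l).
Proof.
move=> xl; rewrite /has_derivative.
have -> : (fun s => (s - t)^-1 *: (x s ^+ 2 - x t ^+ 2)) =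
    (fun s => (s - t)^-1 *: (x s - x t) * (x s + x t)).
  by apply/funext => s; rewrite subr_sqr scalerAl.
have -> : 2 * x t * l = l * (x t + x t) by ring.
by apply: cvgM xl (cvgD (has_derivative_cvg xl) (cvg_cst _)).
Qed.

(** Taking a coordinate is linear, so it commutes with the difference quotient, and continuous, so
    it passes to the limit. *)
Lemma has_derivative_coord {n : nat} {x : R -> 'rV[R]_n} {l : 'rV[R]_n}
    (j : 'I_n) :
  has_derivative J x t l -> has_derivative J (fun s => x s 0 j) t (l 0 j).
Proof.
rewrite /has_derivative => xl.
have -> : (fun s => (s - t)^-1 *: (x s 0 j - x t 0 j)) =
    (fun M : 'rV[R]_n => M 0 j) \o (fun s => (s - t)^-1 *: (x s - x t)).
  by apply/funext => s; rewrite /= !mxE.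
exact: cvg_comp xl (@coord_continuous _ _ _ 0 j l).
Qed.

(** Squaring removes the root and leaves a sum of squared coordinates, so differentiability holds
    even where [x t] is zero. *)
Lemma has_derivative_enorm_sqr {n : nat} {x : R -> 'rV[R]_n} {l : 'rV[R]_n} :
  has_derivative J x t l ->
  has_derivative J (fun s => enorm (x s) ^+ 2) t (2 * dotv (x t) l).
Proof.
move=> xl.
have enormE s : enorm (x s) ^+ 2 = \sum_j x s 0 j ^+ 2.
  rewrite /enorm sqr_sqrtr; first by apply: eq_bigr => j _; rewrite expr2.
  by apply: sumr_ge0 => j _; rewrite -expr2 sqr_ge0.
under eq_fun do rewrite enormE.
rewrite /dotv mulr_sumr; under eq_bigr do rewrite mulrA.
apply: has_derivative_sum => j.
exact/has_derivative_sqr/has_derivative_coord.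
Qed.

End has_derivative_calculus.

Lemma dotvBl (R : realType) (n : nat) (u v w : 'rV[R]_n) :
  dotv (u - v) w = dotv u w - dotv v w.
Proof. by rewrite -sumrB; apply: eq_bigr => j _; rewrite !mxE mulrBl. Qed.

Lemma dotvZr (R : realType) (n : nat) (a : R) (u v : 'rV[R]_n) :
  dotv u (a *: v) = a * dotv u v.
Proof. by rewrite mulr_sumr; apply: eq_bigr => j _; rewrite !mxE mulrCA. Qed.

Theorem proposition4p1 (R : realType) (n : nat) (K Gamma : R)
    (K_gt0 : 0 < K) (Gamma_gt0 : 0 < Gamma)
    (J : set R) (J_itv : time_interval J)
    (f : R -> R -> R) (lambda : 'I_3 -> R -> R) (b : R -> 'rV[R]_n)
    (w : 'I_3 -> 'rV[R]_n)
    (theta_t dtheta_t : R -> R)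
    (theta_t_diff : forall t, J t -> has_derivative J theta_t t (dtheta_t t))
    (theta utilde : R -> R) (what : 'I_3 -> R -> 'rV[R]_n)
    (gain_neq0 : forall t, J t -> gain lambda b (what ^~ t) t != 0)
    (control_law : forall t, J t ->
      utilde t = - (gain lambda b (what ^~ t) t)^-1 *
        (f (theta t) t - dtheta_t t + K * (theta t - theta_t t)))
    (theta_ode : forall t, J t ->
      has_derivative J theta t (f (theta t) t + gain lambda b w t * utilde t))
    (what_ode : forall i t, J t ->
      has_derivative J (what i) t
        ((Gamma * (theta t - theta_t t) * lambda i t * utilde t) *: b t)) :
  let e := fun t => theta t - theta_t t in
  decreasing_along_flow J e (lyapunov Gamma e w what).
Proof.
move=> e t Jt; exists (- K * e t ^+ 2).
split; last 2 first.
- by rewrite mulNr oppr_le0 mulr_ge0 ?sqr_ge0 ?ltW.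
- by move=> et0; rewrite mulNr oppr_lt0 mulr_gt0// exprn_even_gt0.
have e_ode := has_derivativeB (theta_ode t Jt) (theta_t_diff t Jt).
have what_sub_ode i := has_derivativeB (what_ode i t Jt)
  (has_derivative_cst (w i)).
(* The derivative is assembled in the shape of [lyapunov], so that the two functions agree by
   conversion; only its value remains to be simplified. *)
have V_ode := has_derivativeD
  (has_derivativeZ 2^-1 (has_derivative_sqr e_ode))
  (has_derivativeZ (2^-1 * Gamma^-1) (has_derivative_sum (index_enum 'I_3)
    (fun i => has_derivative_enorm_sqr (what_sub_ode i)))).
set v := (X in has_derivative _ _ _ X) in V_ode.
suff <- : v = - K * e t ^+ 2 by exact: V_ode.
(* The control law multiplied through by the nonvanishing estimated gain. *)
have control : gain lambda b (what ^~ t) t * utilde t =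
    - (f (theta t) t - dtheta_t t + K * e t).
  by rewrite control_law// mulrA mulrN divff ?gain_neq0// mulN1r.
(* All three update laws share the factor [Gamma * e t * utilde t]; what is left in each summand is
   [lambda i t] times the weight error paired with [b t], and these add up to the gain error. The
   [- 0] is the derivative of the constant [w i]. *)
have weight_error : \sum_i 2 * dotv (what i t - w i)
      ((Gamma * e t * lambda i t * utilde t) *: b t - 0) =
    2 * Gamma * e t * utilde t *
      (gain lambda b (what ^~ t) t - gain lambda b w t).
  rewrite /gain -sumrB mulr_sumr; apply: eq_bigr => i _.
  by rewrite subr0 dotvZr dotvBl; ring.
rewrite /v weight_error /GRing.scale /= -/(e t).
(* With the gains abstracted to variables this is a field identity: [Gamma^-1] cancels the
   adaptation gain, and the two occurrences of [B] cancel each other. *)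
have -> : forall B Bh F u E : R, 2^-1 * (2 * E * (F + B * u - dtheta_t t)) +
   2^-1 * Gamma^-1 * (2 * Gamma * E * u * (Bh - B)) =
   E * (F - dtheta_t t + Bh * u).
  by move=> *; field; rewrite gt_eqF.
by rewrite control; ring.
Qed.
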